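(* For each $n\ge 1$ let $\Lambda_n:2^{[n]}\to[0,\infty)$ be a non-negative mean measure on the power set $2^{[n]}$, and let $\mu_n$ on $\mathcal{E}_n$, $\nu_n=\mu_n\alpha^{-1}$ on $\mathcal{F}_n$ and $\mu_n^*=\mu_n\alpha^{-1}\beta^{-1}=\nu_n\beta^{-1}$ on $\mathcal{G}_n$ be the associated probability measures defined in the context. The collections $(\mu_n,n\ge1)$ on the projective system $(\mathcal{E}_n,n\ge 1)$ and $(\nu_n,n\ge1)$ on the projective system $(\mathcal{F}_n,n\ge1)$ (each with its restriction and permutation maps) are both infinitely exchangeable if and only if there is a collection of non-negative real numbers $(\lambda_n(r): n\ge 1,\ 0\le r\le n)$ such that (a) for every $n\ge1$, $\Lambda_n(a)=\lambda_n(\#a)$ for all $a\subseteq[n]$; and (b) for every $n\ge 1$, $\lambda_n(r)=\lambda_{n+1}(r)+\lambda_{n+1}(r+1)$ for $r=0,1,\ldots,n$. Moreover, if (a) and (b) hold, then the collection $(\mu_n^*,n\ge1)$ of measures on the projective system $(\mathcal{G}_n,n\ge1)$ (with its restriction and permutation maps) is infinitely exchangeable.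
   Context: Notation: $[n]=\{1,\dots,n\}$, $2^{S}$ is the power set of $S$, $\#a$ is the cardinality of $a$, and $\mathcal{S}_n$ is the group of permutations of $[n]$. Subsets of the power set. $\mathcal{E}_n=2^{2^{[n]}}$ is the set of all collections $E$ of subsets of $[n]$ (including the empty collection). For $m\le n$ the restriction map $\mathcal{E}_n\to\mathcal{E}_m$ is $E\mapsto\{e\cap[m]:e\in E\}$. A permutation $\sigma\in\mathcal{S}_n$ acts by $\sigma(E)=\{\sigma(e):e\in E\}$. Monotone sets. A subset $A\subseteq 2^{[n]}$ is monotone if $a\in A$ implies $2^a\subseteq A$. $\mathcal{F}_n$ is the set of all monotone subsets of $2^{[n]}$ (including the empty one). The generating class $G(A)$ of $A\in\mathcal{F}_n$ is the set of its maximal elements under inclusion; $\langle A_1,\dots,A_k\rangle$ denotes the monotone set $\bigcup_{i}2^{A_i}$. For $m\le n$ the restriction map $\mathcal{F}_n\to\mathcal{F}_m$ is $A\mapsto\langle A_i\cap[m]:i=1,\dots,k\rangle$ where $G(A)=\{A_1,\dots,A_k\}$. A permutation $\sigma\in\mathcal{S}_n$ acts on $A$ through its generating class: $G(\sigma(A))=\{\sigma(a):a\in G(A)\}$. Graphs. $\mathcal{G}_n$ is the set of undirected graphs with vertex set $[n]$, identified with symmetric subsets of $[n]^2$. For $m\le n$ the restriction map $\mathcal{G}_n\to\mathcal{G}_m$ is $G\mapsto G\cap[m]^2$ (induced subgraph). A permutation acts by $(i,j)\in G\iff(\sigma(i),\sigma(j))\in\sigma(G)$. Maps. $\alpha:\mathcal{E}_n\to\mathcal{F}_n$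 sends $E$ to its least monotone cover $\alpha(E)=\bigcup_{a\in E}2^a$. $\beta:\mathcal{F}_n\to\mathcal{G}_n$ sends $F=\langle F_1,\dots,F_k\rangle$ to the graph $G_F$ with $(i,j)\in G_F$ if and only if $\{i,j\}\subseteq F_l$ for some $l\in\{1,\dots,k\}$. Measures. Given $\Lambda_n$, let $\{X_a:a\in2^{[n]}\}$ be independent Poisson random variables with $X_a$ of mean $\Lambda_n(a)$ (mean $0$ meaning $X_a=0$ almost surely), and let $X^*=\{a\subseteq[n]:X_a>0\}\in\mathcal{E}_n$. Then $\mu_n$ is the distribution of $X^*$ on $\mathcal{E}_n$; equivalently $\mu_n(\{E':E'\subseteq E\})=\exp\{-\sum_{a\subseteq[n]:a\notin E}\Lambda_n(a)\}$ for all $E\in\mathcal{E}_n$. $\nu_n=\mu_n\alpha^{-1}$ is the distribution of $\alpha(X^* )$ on $\mathcal{F}_n$, and $\mu_n^*=\nu_n\beta^{-1}$ is the distribution of $\beta(\alpha(X^* ))$ on $\mathcal{G}_n$. Infinite exchangeability. Let $(Q_n,n\ge1)$ be one of the systems above, with restriction maps $D_{m,n}:Q_n\to Q_m$ ($m\le n$) and permutation actions. A family $(p_n,n\ge1)$ of probability measures, $p_n$ on $Q_n$, is infinitely exchangeable if (i) for each $n\ge1$ and $\sigma\in\mathcal{S}_n$, $p_n(A)=p_n(\sigma(A))$ for every $A\in Q_n$; and (ii) for every $m\le n$, $p_m(A)=p_n(D_{m,n}^{-1}(A))$ for every $A\in Q_m$. *)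

(* Defs.v *)
From HB Require Import structures.
From mathcomp Require Import all_boot all_order all_algebra all_fingroup.
From mathcomp Require Import all_classical all_reals all_analysis.

Set Implicit Arguments.
Unset Strict Implicit.
Unset Printing Implicit Defensive.

Import Order.TTheory GRing.Theory Num.Theory.

Local Open Scope ring_scope.

(* The vertex set [n] = {1, ..., n} is 'I_n = {0, ..., n - 1}, so that for
   m <= n the inclusion of [m] in [n] is [widen_ord]. *)

(* e :&: [m], as a subset of 'I_m *)
Definition cap_ord m n (lemn : (m <= n)%N) (e : {set 'I_n}) : {set 'I_m} :=
  [set i : 'I_m | widen_ord lemn i \in e]%SET.

Definition collection (n : nat) : Type := {set {set 'I_n}}.

HB.instance Definition _ n := Finite.on (collection n).
HB.instance Definition _ n := isPointed.Build (collection n) finset.set0.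
HB.instance Definition _ n := @isMeasurable.Build default_measure_display
  (collection n) discrete_measurable discrete_measurable0
  discrete_measurableC discrete_measurableU.

Definition restr_collection m n (lemn : (m <= n)%N) (E : collection n) :
    collection m :=
  [set cap_ord lemn e | e in (E : {set {set 'I_n}})]%SET.

Definition perm_collection n (s : 'S_n) (E : collection n) : collection n :=
  [set s @: (e : {set 'I_n}) | e in (E : {set {set 'I_n}})]%SET.

Definition is_monotone n (A : {set {set 'I_n}}) : bool :=
  [forall a in A, powerset a \subset A].

Record monotone_set (n : nat) : Type := MonotoneSet {
  monotone_val :> {set {set 'I_n}};
  monotone_valP : is_monotone monotone_val }.

HB.instance Definition _ n := [isSub for @monotone_val n].
HB.instance Definition _ n := [Finite of monotone_set n by <:].

(* the generating class G(A) *)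
Definition generators n (A : monotone_set n) : {set {set 'I_n}} :=
  [set a | maxset [pred b | b \in (A : {set {set 'I_n}})] a]%SET.

Lemma is_monotone_span n (S : {set {set 'I_n}}) :
  is_monotone (\bigcup_(a in S) powerset a)%SET.
Proof.
apply/forall_inP => a /bigcupP[b bS]; rewrite powersetE => ab.
apply/fintype.subsetP => c; rewrite powersetE => ca; apply/bigcupP; exists b => //.
by rewrite powersetE (fintype.subset_trans ca).
Qed.

(* < A_1, ..., A_k >, where S = {A_1, ..., A_k} *)
Definition span n (S : {set {set 'I_n}}) : monotone_set n :=
  MonotoneSet (is_monotone_span S).

HB.instance Definition _ n := isPointed.Build (monotone_set n) (span finset.set0).
HB.instance Definition _ n := @isMeasurable.Build default_measure_display
  (monotone_set n) discrete_measurable discrete_measurable0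
  discrete_measurableC discrete_measurableU.

Definition restr_monotone m n (lemn : (m <= n)%N) (A : monotone_set n) :
    monotone_set m :=
  span [set cap_ord lemn a | a in generators A]%SET.

Definition perm_monotone n (s : 'S_n) (A : monotone_set n) : monotone_set n :=
  span [set s @: (a : {set 'I_n}) | a in generators A]%SET.

Lemma generators_perm_monotone n (s : 'S_n) (A : monotone_set n) :
  generators (perm_monotone s A) =
  [set s @: (a : {set 'I_n}) | a in generators A]%SET.
Proof.
have imK (a b : {set 'I_n}) : s @: a \subset s @: b -> a \subset b.
  move=> ab; apply/fintype.subsetP => x xa.
  have /(fintype.subsetP ab) : s x \in s @: a by apply: imset_f.
  by rewrite mem_imset //; apply: perm_inj.
apply/setP => c; apply/idP/imsetP.
  rewrite inE => /maxsetP[/= /bigcupP[_ /imsetP[a aG ->]]].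
  rewrite powersetE => ca /(_ (s @: a)) <- //; first by exists a.
  apply/bigcupP; exists (s @: a); first by apply: imset_f.
  by rewrite powersetE.
case=> a aG ->; rewrite inE; apply/maxsetP; split=> /=.
  apply/bigcupP; exists (s @: a); first by apply: imset_f.
  by rewrite powersetE.
move=> b /bigcupP[_ /imsetP[a' a'G ->]]; rewrite powersetE => ba' ab.
have aa' : a \subset a' by apply: imK; apply: fintype.subset_trans ba'.
move: aG a'G; rewrite !inE => /maxsetP[_ amax] /maxsetP[/= a'A _].
have Eaa' := amax _ a'A aa'; rewrite Eaa' in ba'.
by apply/eqP; rewrite finset.eqEsubset ba' ab.
Qed.

Definition symmetric_edges n (g : {set 'I_n * 'I_n}) : bool :=
  [forall i, forall j, ((i, j) \in g) == ((j, i) \in g)].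

(* Loops are allowed: a graph is an arbitrary symmetric subset of [n]^2. *)
Record graph (n : nat) : Type := Graph {
  edges :> {set 'I_n * 'I_n};
  edgesP : symmetric_edges edges }.

HB.instance Definition _ n := [isSub for @edges n].
HB.instance Definition _ n := [Finite of graph n by <:].

Lemma symmetric_edges0 n : @symmetric_edges n finset.set0.
Proof. by apply/forallP => i; apply/forallP => j; rewrite !inE. Qed.

HB.instance Definition _ n := isPointed.Build (graph n) (Graph (symmetric_edges0 n)).
HB.instance Definition _ n := @isMeasurable.Build default_measure_display
  (graph n) discrete_measurable discrete_measurable0
  discrete_measurableC discrete_measurableU.

Lemma graph_sym n (g : graph n) i j :
  ((i, j) \in edges g) = ((j, i) \in edges g).
Proof. by have /forallP/(_ i)/forallP/(_ j)/eqP := edgesP g. Qed.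

Lemma symmetric_restr m n (lemn : (m <= n)%N) (g : graph n) :
  symmetric_edges [set p : 'I_m * 'I_m |
    (widen_ord lemn p.1, widen_ord lemn p.2) \in edges g]%SET.
Proof. by apply/forallP => i; apply/forallP => j; rewrite !inE /= graph_sym. Qed.

Definition restr_graph m n (lemn : (m <= n)%N) (g : graph n) : graph m :=
  Graph (symmetric_restr lemn g).

Lemma symmetric_perm n (s : 'S_n) (g : graph n) :
  symmetric_edges [set (s p.1, s p.2) | p in edges g]%SET.
Proof.
apply/forallP => i; apply/forallP => j; apply/eqP.
by apply/imsetP/imsetP => -[[k l] klg [-> ->]]; exists (l, k); rewrite // graph_sym.
Qed.

Definition perm_graph n (s : 'S_n) (g : graph n) : graph n :=
  Graph (symmetric_perm s g).

Definition alpha n (E : collection n) : monotone_set n := span E.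

Lemma symmetric_beta n (A : monotone_set n) :
  symmetric_edges [set p : 'I_n * 'I_n |
    [exists a in generators A, [set p.1; p.2] \subset a]]%SET.
Proof.
apply/forallP => i; apply/forallP => j; rewrite !inE /=; apply/eqP.
by apply: eq_existsb => a; rewrite finset.setUC.
Qed.

Definition beta n (A : monotone_set n) : graph n := Graph (symmetric_beta A).

Lemma measurable_alpha n : measurable_fun [set: collection n] (@alpha n).
Proof. by []. Qed.

HB.instance Definition _ n :=
  isMeasurableFun.Build _ _ _ _ (@alpha n) (@measurable_alpha n).

Lemma measurable_beta n : measurable_fun [set: monotone_set n] (@beta n).
Proof. by []. Qed.

HB.instance Definition _ n :=
  isMeasurableFun.Build _ _ _ _ (@beta n) (@measurable_beta n).

Definition mutually_independent (R : realType) (I : finType) d d'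
    (T : measurableType d) (T' : measurableType d') (P : probability T R)
    (X : I -> {RV P >-> T'}) : Prop :=
  forall (J : {set I}) (B : I -> set T'),
    (forall i, i \in J -> measurable (B i)) ->
    P [set w | forall i, i \in J -> B i (X i w)]%classic =
    (\prod_(i in J) P (X i @^-1` B i)%classic)%E.

(* [poisson_prob r k] is the Poisson law of mean r for every k (its second
   argument is unused); it is the Dirac mass at 0 when r = 0. *)
Definition is_poisson (R : realType) d (T : measurableType d)
    (P : probability T R) (X : {RV P >-> nat}) (r : R) : Prop :=
  forall B : set nat, distribution P X B = poisson_prob r 0 B.

Definition positive_support (R : realType) n d (T : measurableType d)
    (P : probability T R) (X : {set 'I_n} -> {RV P >-> nat}) (w : T) :
    collection n :=
  [set a | 0 < X a w]%N%SET.

Lemma measurable_positive_support (R : realType) n d (T : measurableType d)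
    (P : probability T R) (X : {set 'I_n} -> {RV P >-> nat}) :
  measurable_fun [set: T] (positive_support X).
Proof.
move=> _ Y _; rewrite setTI.
have -> : (positive_support X @^-1` Y =
    \bigcup_(E in Y) \bigcap_(a in [set: {set 'I_n}])
      X a @^-1` [set k | (0 < k)%N = (a \in (E : {set {set 'I_n}}))])%classic.
  apply/seteqP; split=> w /=.
    by move=> Yw; exists (positive_support X w) => // a _ /=; rewrite inE.
  case=> E YE Ew; rewrite (_ : positive_support X w = E) //.
  by apply/setP => a; rewrite inE; exact: Ew.
apply: fin_bigcup_measurable; first exact: finite_finset.
move=> E _; apply: fin_bigcap_measurable; first exact: finite_finset.
by move=> a _; apply: measurable_funPTI.
Qed.

HB.instance Definition _ (R : realType) n d (T : measurableType d)
    (P : probability T R) (X : {set 'I_n} -> {RV P >-> nat}) :=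
  isMeasurableFun.Build _ _ _ _ (positive_support X)
    (measurable_positive_support X).

Definition mu (R : realType) n d (T : measurableType d) (P : probability T R)
    (X : {set 'I_n} -> {RV P >-> nat}) : probability (collection n) R :=
  distribution P (positive_support X).

Definition nu (R : realType) n d (T : measurableType d) (P : probability T R)
    (X : {set 'I_n} -> {RV P >-> nat}) : probability (monotone_set n) R :=
  distribution (mu X) (@alpha n).

Definition mu_star (R : realType) n d (T : measurableType d)
    (P : probability T R) (X : {set 'I_n} -> {RV P >-> nat}) :
    probability (graph n) R :=
  distribution (nu X) (@beta n).

Definition infinitely_exchangeable (R : realType) d
    (Q : nat -> measurableType d)
    (D : forall m n, (m <= n)%N -> Q n -> Q m)
    (act : forall n, 'S_n -> Q n -> Q n)
    (p : forall n, probability (Q n) R) : Prop :=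
  (forall n (s : 'S_n) (A : Q n), (0 < n)%N ->
     p n [set A]%classic = p n [set act n s A]%classic) /\
  (forall m n (lemn : (m <= n)%N) (A : Q m), (0 < m)%N ->
     p m [set A]%classic = p n (D m n lemn @^-1` [set A])%classic).

(* Main.v *)
(* Restricting or permuting a collection is taking its image under a map h of
   vertex subsets. The image of the support of an independent Poisson family is
   again the support of such a family, whose means are the sums of the means
   over the fibres of h, and the void probabilities exp(- Lambda a) recover the
   means. Exchangeability of (mu_n) is therefore equivalent to invariance of
   Lambda_n under permutations, which is (a), together with Lambda_m being the
   sum of Lambda_n over the fibres of a |-> a :&: [m]. For n = m + 1 a fibre is
   {b, b :|: {m + 1}}, so the latter is (b). Since alpha and beta commute with
   restrictions and permutations, exchangeability passes to nu_n and mu_n^*. *)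
Require Import Defs.
From HB Require Import structures.
From mathcomp Require Import all_boot all_order all_algebra all_fingroup.
From mathcomp Require Import all_classical all_reals all_analysis.

Set Implicit Arguments.
Unset Strict Implicit.
Unset Printing Implicit Defensive.

Import Order.TTheory GRing.Theory Num.Theory.

Local Open Scope ring_scope.

(** * Permutations and measures on finite sets *)

Lemma exists_perm_imset (T : finType) (a b : {set T}) :
  #|a| = #|b| -> exists s : {perm T}, s @: a = b.
Proof.
move=> ab.
pose enum2 (c : {set T}) := enum c ++ enum (~: c)%SET.
have size_enum2 c : size (enum2 c) = #|T| by rewrite size_cat -!cardE cardsC.
have uniq_enum2 c : uniq (enum2 c).
  rewrite cat_uniq !enum_uniq andbT /=.
  by apply/hasPn => x; rewrite /= !mem_enum inE.
have mem_enum2 c x : x \in enum2 c by rewrite mem_cat !mem_enum inE orbN.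
(* [f] matches positions: the entry of [enum2 a] at a given index goes to the entry of [enum2 b] at
   the same index. *)
pose f x := nth x (enum2 b) (index x (enum2 a)).
have lt_index x : (index x (enum2 a) < size (enum2 b))%N.
  by rewrite size_enum2 -(size_enum2 a) index_mem.
have f_inj : injective f.
  move=> x y; rewrite /f (set_nth_default y) // => /eqP.
  by rewrite nth_uniq // => /eqP; apply: index_inj; rewrite ?inE.
(* Equal cardinalities reduce the equality to an inclusion. It holds because [a] and [b] fill the
   first [#|a|] positions of their lists. *)
exists (perm f_inj); apply/eqP; rewrite eqEcard card_imset; last exact: perm_inj.
rewrite ab leqnn andbT; apply/fintype.subsetP => _ /imsetP[x xa ->].
rewrite permE /f index_cat mem_enum xa nth_cat -cardE -ab cardE index_mem.
by rewrite mem_enum xa -mem_enum mem_nth // -cardE -ab cardE index_mem mem_enum.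
Qed.

Lemma measure_preimageE (R : realType) d (T : measurableType d) (T' : choiceType)
    (p : {measure set T -> \bar R}) (f : T -> T') (B : set T') :
  finite_set B -> (forall C, measurable (f @^-1` C)%classic) ->
  (p (f @^-1` B)%classic = \sum_(x \in B) p (f @^-1` [set x])%classic)%E.
Proof.
move=> finB mf; rewrite -measure_fin_bigcup //.
  by congr (p _); apply/seteqP; split=> [x Bx|x [y By /= fxy]];
    [exists (f x)|rewrite /= fxy].
apply/trivIsetP => x y _ _ xy; apply/seteqP; split=> // z [/= -> /eqP].
by rewrite (negPf xy).
Qed.

(** Möbius inversion by strong induction on [#|E|]: the mass at [E] is the mass of the subsets of
    [E] minus that of the proper subsets, where the two laws already agree. *)
Lemma measure_preimage_subset_uniq (R : realType) (I : finType) d d'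
    (T : measurableType d) (T' : measurableType d') (p : probability T R)
    (q : probability T' R) (f : T -> {set I}) (g : T' -> {set I}) :
  (forall C, measurable (f @^-1` C)%classic) ->
  (forall C, measurable (g @^-1` C)%classic) ->
  (forall E : {set I}, p (f @^-1` [set E' | E' \subset E])%classic =
             q (g @^-1` [set E' | E' \subset E])%classic) ->
  forall E : {set I}, p (f @^-1` [set E])%classic = q (g @^-1` [set E])%classic.
Proof.
move=> mf mg fg E.
pose strict (E0 : {set I}) := [set F : {set I} | F \proper E0]%classic.
have splitE (d0 : measure_display) (U : measurableType d0) (r : probability U R)
    (h : U -> {set I}) (E0 : {set I}) : (forall C, measurable (h @^-1` C)%classic) ->
    (r (h @^-1` [set E' | E' \subset E0])%classic =
     r (h @^-1` [set E0])%classic + r (h @^-1` strict E0)%classic)%E.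
  move=> mh; rewrite -measureU //.
    congr (r _); apply/seteqP; split=> x /=.
      by rewrite finset.subEproper => /orP[/eqP|]; [left|right].
    by case=> [->|/proper_sub].
  by apply/seteqP; split=> // x [/= ->]; rewrite /strict /= fintype.properxx.
have [k] := ubnP #|E|; elim: k E => // k IH E; rewrite ltnS => Ek.
have Estrict : p (f @^-1` strict E)%classic = q (g @^-1` strict E)%classic.
  rewrite !measure_preimageE //; [|exact: finite_finset..].
  apply: eq_fsbigr => F; rewrite inE => /= FE.
  by apply: IH; apply: leq_trans (proper_card FE) _.
have := fg E; rewrite !splitE // Estrict.
(* Values lie in the extended reals, so cancelling the common term requires it to be finite. *)
move/(congr1 (fun z => z - q (g @^-1` strict E)%classic)%E).
by rewrite !addeK //; apply: fin_num_measure; exact: mg.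
Qed.

(** * Void probabilities of Poisson supports *)

Lemma poisson_prob_set0 (R : realType) (r : R) :
  0 <= r -> poisson_prob r 0 [set 0%N]%classic = (expR (- r))%:E.
Proof.
rewrite le_eqVlt /poisson_prob => /orP[/eqP <-|r0].
  by rewrite ltxx oppr0 expR0 diracE mem_set.
rewrite r0 esum_set1 ?lee_fin ?poisson_pmf_ge0 // /poisson_pmf r0.
by rewrite expr0 fact0 invr1 !mul1r.
Qed.

(** The support lies in [E] exactly when [X a = 0] for all [a] outside [E]; by independence the
    factors [expR (- Lambda a)] multiply. *)
Lemma mu_subset (R : realType) n d (T : measurableType d) (P : probability T R)
    (Lambda : {set 'I_n} -> R) (X : {set 'I_n} -> {RV P >-> nat}) :
  (forall a, 0 <= Lambda a) -> mutually_independent X ->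
  (forall a, is_poisson (X a) (Lambda a)) ->
  forall E : {set {set 'I_n}},
    mu X [set E' | (E' : {set {set 'I_n}}) \subset E]%classic =
    (expR (- \sum_(a in ~: E) Lambda a))%:E.
Proof.
move=> Lambda_ge0 X_indep X_poisson E.
rewrite -sumrN expR_sum -prodEFin.
transitivity (\prod_(a in ~: E) P (X a @^-1` [set 0%N])%classic)%E.
  rewrite -X_indep //; congr (P _); apply/seteqP; split=> w /= XE.
    move=> a; rewrite inE => aE; apply/eqP; rewrite -leqn0 leqNgt.
    by apply: contra aE => Xa; apply: (fintype.subsetP XE); rewrite inE.
  apply/fintype.subsetP => a; rewrite inE; apply: contraTT => aE.
  by rewrite -leqNgt leqn0; apply/eqP/XE; rewrite inE.
apply: eq_bigr => a _; rewrite -poisson_prob_set0 //.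
exact: X_poisson.
Qed.

(** Permutation invariance is the case [h a = s @: a], and compatibility with restriction is the
    case [h = cap_ord lemn]. The key fact is that [h @: E'] lies in [E] iff [E'] lies in the
    preimage of [E]. *)
Lemma mu_imsetP (R : realType) m n d (T : measurableType d)
    (P : probability T R) (X : {set 'I_m} -> {RV P >-> nat}) d'
    (T' : measurableType d') (P' : probability T' R)
    (Y : {set 'I_n} -> {RV P' >-> nat})
    (L : {set 'I_m} -> R) (M : {set 'I_n} -> R) (h : {set 'I_n} -> {set 'I_m}) :
  (forall a, 0 <= L a) -> mutually_independent X ->
  (forall a, is_poisson (X a) (L a)) ->
  (forall a, 0 <= M a) -> mutually_independent Y ->
  (forall a, is_poisson (Y a) (M a)) ->
  (forall A : collection m, mu X [set A]%classic =
     mu Y ((fun E : collection n => h @: (E : {set {set 'I_n}}) : collection m)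
       @^-1` [set A])%classic) <->
  (forall b, L b = \sum_(a | h a == b) M a).
Proof.
move=> L0 X_indep X_poisson M0 Y_indep Y_poisson.
set H := fun E : collection n => _.
have cdfH (E : {set {set 'I_m}}) :
    mu Y (H @^-1` [set E' | (E' : {set {set 'I_m}}) \subset E])%classic =
    (expR (- \sum_(b in ~: E) \sum_(a | h a == b) M a))%:E.
  rewrite (_ : (_ @^-1` _)%classic = [set E' | (E' : {set {set 'I_n}}) \subset
      (h @^-1: E)%SET]%classic); last first.
    by apply/seteqP; split=> E' /=; rewrite /H sub_imset_pre.
  rewrite (mu_subset M0) //; congr (expR (- _))%:E.
  rewrite (partition_big h (fun b => b \in ~: E)) /=.
    apply: eq_bigr => b bE; apply: eq_bigl => a.
    by rewrite !inE; case: eqP => [->|]; rewrite ?andbT ?andbF // -finset.in_setC.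
  by move=> a; rewrite !inE.
split=> [eqA b|LM A].
  (* Avoiding the single point [b] has probability [expR (- L b)] on one side and [expR] of minus
     the fibre sum on the other, so injectivity of [expR] isolates [L b]. *)
  have : mu X [set E' | (E' : {set {set 'I_m}}) \subset ~: [set b]]%classic =
      mu Y (H @^-1` [set E' | (E' : {set {set 'I_m}}) \subset ~: [set b]])%classic.
    rewrite -[in LHS](preimage_id [set E' | _]%classic).
    rewrite !measure_preimageE //; [|exact: finite_finset..].
    by apply: eq_fsbigr => A _; exact: eqA.
  rewrite (mu_subset L0) // cdfH => -[/expR_inj/oppr_inj].
  by rewrite finset.setCK !big_set1.
apply: (measure_preimage_subset_uniq (p := mu X) (q := mu Y)
  (f := id) (g := H)) => // E.
rewrite preimage_id (mu_subset L0) // cdfH; congr (expR (- _))%:E.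
by apply: eq_bigr => b _; exact: LM.
Qed.

(** * Sums over fibres of restrictions and permutations *)

Lemma cap_ord_comp m n k (lemn : (m <= n)%N) (lenk : (n <= k)%N)
    (lemk : (m <= k)%N) (e : {set 'I_k}) :
  cap_ord lemn (cap_ord lenk e) = cap_ord lemk e.
Proof.
by apply/setP => i; rewrite !inE; congr (_ \in e); apply: val_inj.
Qed.

Lemma cap_ord_id n (lenn : (n <= n)%N) (e : {set 'I_n}) : cap_ord lenn e = e.
Proof. by apply/setP => i; rewrite inE; congr (_ \in e); apply: val_inj. Qed.

Lemma sum_cap_ordS (R : zmodType) n (len : (n <= n.+1)%N) (F : {set 'I_n.+1} -> R)
    (b : {set 'I_n}) :
  \sum_(a | cap_ord len a == b) F a =
  F (widen_ord len @: b) + F (ord_max |: (widen_ord len @: b))%SET.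
Proof.
have widen_inj : injective (widen_ord len) by move=> i j [/val_inj].
have max_notin : ord_max \notin widen_ord len @: b.
  by apply/imsetP => -[i _ /(congr1 val) /= ni]; have := ltn_ord i; rewrite -ni ltnn.
have max_neq i : (widen_ord len i == ord_max) = false.
  by apply/negbTE; rewrite -val_eqE /= neq_ltn ltn_ord.
have cap0 : cap_ord len (widen_ord len @: b) = b.
  by apply/setP => i; rewrite inE mem_imset.
have cap1 : cap_ord len (ord_max |: widen_ord len @: b) = b.
  by apply/setP => i; rewrite !inE max_neq mem_imset.
rewrite (bigD1 (widen_ord len @: b)) ?cap0 //=.
rewrite (bigD1 (ord_max |: widen_ord len @: b)%SET) /=; last first.
  rewrite cap1 eqxx; apply: contraNneq max_notin => <-.
  by rewrite setU11.
(* No third set is in the fibre: [a] is determined by [b] away from [ord_max], so membership of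
   [ord_max] leaves only the two sets already extracted. *)
rewrite big1 ?addr0 // => a /andP[/andP[/eqP capa a0] a1].
have memw i : (widen_ord len i \in a) = (i \in b) by rewrite -capa inE.
have a_widen j : j != ord_max -> (j \in a) = (j \in widen_ord len @: b).
  move=> jmax.
  have jn : (j < n)%N by rewrite ltn_neqAle -ltnS ltn_ord andbT -val_eqE in jmax *.
  have -> : j = widen_ord len (Ordinal jn) by apply: val_inj.
  by rewrite memw mem_imset.
have [amax|amax] := boolP (ord_max \in a).
  case/eqP: a1; apply/setP => j; rewrite !inE.
  by have [->//|/a_widen] := eqVneq j ord_max.
case/eqP: a0; apply/setP => j.
have [->|/a_widen//] := eqVneq j ord_max.
by rewrite (negPf amax) (negPf max_notin).
Qed.

Lemma card_widen_imset n (len : (n <= n.+1)%N) (b : {set 'I_n}) :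
  #|widen_ord len @: b| = #|b| /\ #|ord_max |: widen_ord len @: b| = #|b|.+1.
Proof.
have -> : #|widen_ord len @: b| = #|b|.
  by apply: card_imset => i j [/val_inj].
split=> //; rewrite cardsU1 card_imset; last by move=> i j [/val_inj].
case: imsetP => [[i _ /(congr1 val) /= ni]|//].
by have := ltn_ord i; rewrite -ni ltnn.
Qed.

(** Restrictions compose, so the fibre over [b] splits according to the trace one level down, and
    induction on [n] reduces everything to one-step restrictions. *)
Lemma sum_cap_ord (R : zmodType) (Lambda : forall n, {set 'I_n} -> R) :
  (forall n (b : {set 'I_n}), (0 < n)%N ->
     Lambda n b = \sum_(a | cap_ord (leqnSn n) a == b) Lambda n.+1 a) ->
  forall m n (lemn : (m <= n)%N) (b : {set 'I_m}), (0 < m)%N ->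
    Lambda m b = \sum_(a | cap_ord lemn a == b) Lambda n a.
Proof.
move=> LambdaS m n; elim: n => [|n IH] lemn b m0; first by case: m m0 lemn b.
have [mn|nm] := leqP m n.
  rewrite (IH mn) // (partition_big (cap_ord (leqnSn n))
    (fun c => cap_ord mn c == b)) /=; last by move=> a; rewrite cap_ord_comp.
  apply: eq_bigr => c /eqP capc; rewrite LambdaS ?(leq_trans m0) //.
  apply: eq_bigl => a; rewrite -(cap_ord_comp mn (leqnSn n)).
  by case: (eqVneq _ c) => [->|]; rewrite ?capc ?eqxx ?andbF.
(* The remaining case is restriction from a level to itself, whose fibres are singletons. *)
have mE : m = n.+1 by apply/eqP; rewrite eqn_leq lemn nm.
move: lemn b m0; rewrite {}mE => lemn b _.
by rewrite -[LHS](big_pred1_eq +%R b); apply: eq_bigl => a; rewrite cap_ord_id.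
Qed.

Lemma imset_perm_inj n (s : 'S_n) :
  injective (fun a : {set 'I_n} => s @: a).
Proof. exact: imset_inj (@perm_inj _ s). Qed.

Lemma sum_perm_imset (R : zmodType) n (F : {set 'I_n} -> R) (s : 'S_n)
    (b : {set 'I_n}) :
  \sum_(a : {set 'I_n} | s @: a == b) F a = F ((s^-1)%g @: b).
Proof.
rewrite -[RHS](big_pred1_eq +%R ((s^-1)%g @: b)); apply: eq_bigl => a.
apply/eqP/eqP => [<-|->]; rewrite -imset_comp.
  by rewrite -[LHS]imset_id; apply: eq_imset => i /=; rewrite permK.
by rewrite -[RHS]imset_id; apply: eq_imset => i /=; rewrite permKV.
Qed.

Lemma perm_collection_bij n (s : 'S_n) : bijective (perm_collection s).
Proof.
have inj t : injective (@perm_collection n t).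
  exact: imset_inj (@imset_perm_inj n t).
exact: injF_bij.
Qed.

Lemma subset_perm_imset n (s : 'S_n) (a b : {set 'I_n}) :
  (b \subset s @: a) = (s @^-1: b \subset a).
Proof.
apply/fintype.subsetP/fintype.subsetP => ba x.
  by rewrite inE => /ba; rewrite mem_imset //; exact: perm_inj.
rewrite -[x](permKV s) => xb; rewrite mem_imset; last exact: perm_inj.
by apply: ba; rewrite inE.
Qed.

Lemma exists_in_imset (T T' : finType) (f : T -> T') (A : {set T})
    (p : pred T') :
  [exists y in f @: A, p y] = [exists x in A, p (f x)].
Proof.
apply/exists_inP/exists_inP => [[_ /imsetP[x xA ->] px]|[x xA px]].
  by exists x.
by exists (f x); rewrite // imset_f.
Qed.

(** * Membership criteria for monotone sets and graphs *)

Lemma mem_span n (S : {set {set 'I_n}}) (b : {set 'I_n}) :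
  (b \in (Defs.span S : {set _})) = [exists a in S, b \subset a].
Proof.
apply/bigcupP/exists_inP => -[a aS ba]; exists a => //; move: ba;
  by rewrite powersetE.
Qed.

Lemma monotone_subset n (A : monotone_set n) (a b : {set 'I_n}) :
  a \in (A : {set _}) -> b \subset a -> b \in (A : {set _}).
Proof.
move=> aA ba; have /forall_inP/(_ a aA)/fintype.subsetP := monotone_valP A.
by apply; rewrite powersetE.
Qed.

(** Every member lies below a maximal one, which inherits an upward closed property. This removes
    [generators] from the restriction, the permutation action and [beta]. *)
Lemma exists_generators n (A : monotone_set n) (p : pred {set 'I_n}) :
  (forall a b : {set 'I_n}, a \subset b -> p a -> p b) ->
  [exists a in generators A, p a] = [exists a in (A : {set _}), p a].
Proof.
move=> p_up; apply/exists_inP/exists_inP => -[a aA pa].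
  by exists a => //; move: aA; rewrite inE => /maxsetP[].
have [b bmax ab] := @maxset_exists _ [pred b | b \in (A : {set _})] a aA.
by exists b; [rewrite inE | apply: p_up pa].
Qed.

Lemma mem_restr_monotone m n (lemn : (m <= n)%N) (A : monotone_set n)
    (b : {set 'I_m}) :
  (b \in (restr_monotone lemn A : {set _})) =
  (widen_ord lemn @: b \in (A : {set _})).
Proof.
have sub_cap a : (b \subset cap_ord lemn a) = (widen_ord lemn @: b \subset a).
  by rewrite sub_imset_pre; congr (_ \subset _); apply/setP => i; rewrite !inE.
rewrite mem_span exists_in_imset exists_generators => [|a c ac]; last first.
  by rewrite !sub_cap => /fintype.subset_trans; apply.
apply/exists_inP/idP => [[a aA]|bA].
  by rewrite sub_cap; apply: monotone_subset.
by exists (widen_ord lemn @: b); rewrite // sub_cap.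
Qed.

Lemma mem_perm_monotone n (s : 'S_n) (A : monotone_set n) (b : {set 'I_n}) :
  (b \in (perm_monotone s A : {set _})) = (s @^-1: b \in (A : {set _})).
Proof.
rewrite mem_span exists_in_imset exists_generators => [|a c ac]; last first.
  by rewrite !subset_perm_imset => /fintype.subset_trans; apply.
apply/exists_inP/idP => [[a aA]|bA].
  by rewrite subset_perm_imset; apply: monotone_subset.
by exists (s @^-1: b); rewrite // subset_perm_imset.
Qed.

Lemma mem_beta n (A : monotone_set n) (i j : 'I_n) :
  ((i, j) \in edges (beta A)) = ([set i; j]%SET \in (A : {set _})).
Proof.
rewrite inE exists_generators /= => [|a b ab]; last first.
  by move/fintype.subset_trans; apply.
apply/exists_inP/idP => [[a aA]|ijA]; first exact: monotone_subset.
by exists [set i; j]%SET.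
Qed.

(** * Equivariance of [alpha] and [beta] *)

Lemma restr_alpha m n (lemn : (m <= n)%N) (E : collection n) :
  restr_monotone lemn (alpha E) = alpha (restr_collection lemn E).
Proof.
apply/val_inj/setP => b; rewrite [LHS]mem_restr_monotone !mem_span exists_in_imset.
apply: eq_existsb => a; rewrite sub_imset_pre; congr (_ && (_ \subset _)).
Qed.

Lemma perm_alpha n (s : 'S_n) (E : collection n) :
  perm_monotone s (alpha E) = alpha (perm_collection s E).
Proof.
apply/val_inj/setP => b; rewrite [LHS]mem_perm_monotone !mem_span exists_in_imset.
by apply: eq_existsb => a; rewrite subset_perm_imset.
Qed.

Lemma restr_beta m n (lemn : (m <= n)%N) (A : monotone_set n) :
  restr_graph lemn (beta A) = beta (restr_monotone lemn A).
Proof.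
apply/val_inj/setP => -[i j]; rewrite [LHS]inE !mem_beta mem_restr_monotone.
by rewrite imsetU !imset_set1.
Qed.

Lemma perm_beta n (s : 'S_n) (A : monotone_set n) :
  perm_graph s (beta A) = beta (perm_monotone s A).
Proof.
have inj2 : injective (fun p : 'I_n * 'I_n => (s p.1, s p.2)).
  by move=> [i j] [k l] [/perm_inj -> /perm_inj ->].
apply/val_inj/setP => -[i j]; rewrite [RHS]mem_beta mem_perm_monotone.
(* Writing both endpoints as images under [s] turns membership in the permuted edge set into
   membership of the original edge. *)
rewrite -[i](permKV s) -[j](permKV s).
set i' := (s^-1)%g i; set j' := (s^-1)%g j.
transitivity ((i', j') \in edges (beta A));
  first exact: (mem_imset (edges (beta A)) (i', j') inj2).
rewrite mem_beta; have -> // : [set i'; j']%SET = s @^-1: [set s i'; s j'].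
by apply/setP => k; rewrite !inE !(inj_eq (@perm_inj _ s)).
Qed.

Lemma perm_monotone_inj n (s : 'S_n) : injective (perm_monotone s).
Proof.
move=> A B AB; apply/val_inj/setP => b.
have bE : b = s @^-1: (s @: b).
  by apply/setP => i; rewrite inE mem_imset //; exact: perm_inj.
by rewrite bE -[LHS]mem_perm_monotone AB mem_perm_monotone.
Qed.

Lemma perm_graph_inj n (s : 'S_n) : injective (perm_graph s).
Proof.
move=> g g' /(congr1 (@edges n)) /imset_inj gg'; apply/val_inj/gg'.
by move=> [i j] [k l] [/perm_inj -> /perm_inj ->].
Qed.

(** * Transfer of exchangeability along equivariant maps *)

Lemma exchangeable_distribution (R : realType) d d'
    (Q : nat -> measurableType d) (Q' : nat -> measurableType d')
    (D : forall m n, (m <= n)%N -> Q n -> Q m) (act : forall n, 'S_n -> Q n -> Q n)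
    (D' : forall m n, (m <= n)%N -> Q' n -> Q' m)
    (act' : forall n, 'S_n -> Q' n -> Q' n)
    (p : forall n, probability (Q n) R) (f : forall n, {mfun Q n >-> Q' n}) :
  (forall n, finite_set [set: Q n]) ->
  (forall n (B : set (Q n)), measurable B) ->
  (forall n (s : 'S_n), bijective (act n s)) ->
  (forall n (s : 'S_n), injective (act' n s)) ->
  (forall m n (lemn : (m <= n)%N) x, D' m n lemn (f n x) = f m (D m n lemn x)) ->
  (forall n (s : 'S_n) x, act' n s (f n x) = f n (act n s x)) ->
  infinitely_exchangeable D act p ->
  infinitely_exchangeable D' act' (fun n => distribution (p n) (f n)).
Proof.
move=> finQ mQ act_bij act'_inj fD fact [p_act p_D].
have finB n (B : set (Q n)) : finite_set B by exact: sub_finite_set (finQ n).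
have pE n (B : set (Q n)) : (p n B = \sum_(x \in B) p n [set x]%classic)%E.
  by rewrite -[in LHS](preimage_id B) measure_preimageE //; exact: finB.
split=> [n s A n0|m n lemn A m0].
  change (p n (f n @^-1` [set A])%classic =
          p n (f n @^-1` [set act' n s A])%classic).
  (* Injectivity of [act'] gives [f x = A] iff [f (act x) = act' A]. What is left is invariance of
     [p] on a set, obtained by summing over its points. *)
  transitivity (p n (act n s @^-1` (f n @^-1` [set act' n s A]))%classic).
    congr (p n _); apply/seteqP; split=> x /=; rewrite -fact; first by move=> ->.
    exact: act'_inj.
  rewrite [in RHS]pE (measure_preimageE _ (f := act n s)) //; last exact: finB.
  apply: eq_fsbigr => y _.
  have [g actK gK] := act_bij n s.
  rewrite -[in RHS](gK y) -p_act //=; congr (p n _).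
  by apply/seteqP; split=> x /= => [<-|->].
change (p m (f m @^-1` [set A])%classic =
        p n (f n @^-1` (D' m n lemn @^-1` [set A]))%classic).
transitivity (p n (D m n lemn @^-1` (f m @^-1` [set A]))%classic); last first.
  by congr (p n _); apply/seteqP; split=> x /=; rewrite fD.
rewrite pE measure_preimageE //; last exact: finB.
by apply: eq_fsbigr => y _; exact: p_D.
Qed.

Theorem theorem2p1 (R : realType)
  (Lambda : forall n : nat, {set 'I_n} -> R)
  (Lambda_ge0 : forall (n : nat) (a : {set 'I_n}), (0 < n)%N -> 0 <= Lambda n a)
  (d : nat -> measure_display) (T : forall n : nat, measurableType (d n))
  (P : forall n : nat, probability (T n) R)
  (X : forall n : nat, {set 'I_n} -> {RV (P n) >-> nat})
  (X_indep : forall n : nat, (0 < n)%N -> mutually_independent (X n))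
  (X_poisson : forall (n : nat) (a : {set 'I_n}), (0 < n)%N ->
     is_poisson (X n a) (Lambda n a)) :
  let cond (lambda : nat -> nat -> R) :=
    [/\ forall n r : nat, (0 < n)%N -> (r <= n)%N -> 0 <= lambda n r,
        forall (n : nat) (a : {set 'I_n}), (0 < n)%N ->
          Lambda n a = lambda n #|a|
      & forall n r : nat, (0 < n)%N -> (r <= n)%N ->
          lambda n r = lambda n.+1 r + lambda n.+1 r.+1] in
  ((infinitely_exchangeable restr_collection perm_collection
      (fun n => mu (X n)) /\
    infinitely_exchangeable restr_monotone perm_monotone
      (fun n => nu (X n)))
   <-> exists lambda, cond lambda) /\
  (forall lambda, cond lambda ->
    infinitely_exchangeable restr_graph perm_graph
      (fun n => mu_star (X n))).
Proof.
move=> cond.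
have image_mu m n (m0 : (0 < m)%N) (n0 : (0 < n)%N) (h : {set 'I_n} -> {set 'I_m}) :=
  mu_imsetP h (fun a => Lambda_ge0 m a m0) (X_indep m m0)
    (fun a => X_poisson m a m0) (fun a => Lambda_ge0 n a n0) (X_indep n n0)
    (fun a => X_poisson n a n0).
(* Exchangeability speaks of the permuted point, while [mu_imsetP] speaks of a preimage; this
   identity translates between them. *)
have perm_preimage n (s : 'S_n) (A : collection n) :
    (perm_collection s @^-1` [set perm_collection s A] = [set A])%classic.
  apply/seteqP; split=> E /=; last by move=> ->.
  exact: (bij_inj (perm_collection_bij s)).
have exch_mu lambda : cond lambda ->
    infinitely_exchangeable restr_collection perm_collection
      (fun n => mu (X n)).
  case=> lambda0 LambdaE lambdaS; split=> [n s A n0|m n lemn A m0].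
    rewrite -(perm_preimage n s A); apply/esym.
    apply: (image_mu n n n0 n0 (fun a => s @: a)).2 => b.
    by rewrite sum_perm_imset !LambdaE // card_imset //; exact: perm_inj.
  have n0 := leq_trans m0 lemn.
  apply: (image_mu m n m0 n0 (cap_ord lemn)).2 => b.
  apply: (sum_cap_ord (Lambda := Lambda)) => // k c k0.
  (* The two sets in the fibre have sizes [#|c|] and [#|c|.+1], so (a) turns the one-step identity
     into (b). *)
  rewrite sum_cap_ordS !LambdaE //.
  have [-> ->] := card_widen_imset (leqnSn k) c.
  by apply: lambdaS; rewrite // -[k in (_ <= k)%N]card_ord max_card.
have exch_nu lambda : cond lambda ->
    infinitely_exchangeable restr_monotone perm_monotone (fun n => nu (X n)).
  move=> /exch_mu; apply: exchangeable_distribution => //.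
  - by move=> n; exact: finite_finset.
  - exact: perm_collection_bij.
  - exact: perm_monotone_inj.
  - exact: restr_alpha.
  - exact: perm_alpha.
split; last first.
  move=> lambda /exch_nu; apply: exchangeable_distribution => //.
  - by move=> n; exact: finite_finset.
  - by move=> n s; exact: injF_bij (@perm_monotone_inj n s).
  - exact: perm_graph_inj.
  - exact: restr_beta.
  - exact: perm_beta.
split=> [[[mu_perm mu_restr] _]|[lambda condl]]; last first.
  by split; [exact: exch_mu condl | exact: exch_nu condl].
(* A standard set of size [r], at which [Lambda n] will be evaluated to define [lambda n r]. *)
pose initial n r : {set 'I_n} := [set i : 'I_n | (i < r)%N]%SET.
have card_initial n r : (r <= n)%N -> #|initial n r| = r.
  move=> rn; rewrite cardsE -sum1_card (eq_bigl (fun i : 'I_n => (i < r)%N)) //.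
  by rewrite -(big_ord_widen _ (fun=> 1%N) rn) sum1_card card_ord.
(* Sets of equal size are exchanged by some [s], and invariance of [mu] under [s] forces equal
   means. *)
have LambdaE n (a b : {set 'I_n}) : (0 < n)%N -> #|a| = #|b| ->
    Lambda n a = Lambda n b.
  move=> n0 /exists_perm_imset[s <-].
  have /(image_mu n n n0 n0 (fun a => s @: a)).1/(_ (s @: a)) : forall A : collection n,
      mu (X n) [set A]%classic =
      mu (X n) (perm_collection s @^-1` [set A])%classic.
    have [g gK Kg] := perm_collection_bij s.
    by move=> A; rewrite -(Kg A) perm_preimage; apply/esym/mu_perm.
  move=> ->; rewrite sum_perm_imset -imset_comp -[in LHS](imset_id a).
  by congr (Lambda n _); apply: eq_imset => i /=; rewrite permK.
exists (fun n r => Lambda n (initial n r)); split=> [n r n0 _|n a n0|n r n0 rn].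
- exact: Lambda_ge0.
- by apply: LambdaE; rewrite // card_initial // -[n in (_ <= n)%N]card_ord max_card.
(* Consistency between levels [n] and [n.+1], read at [initial n r], gives (b): the fibre consists
   of one set of size [r] and one of size [r.+1]. *)
have /(image_mu n n.+1 n0 isT (cap_ord (leqnSn n))).1/(_ (initial n r)) ->:
    forall A : collection n, mu (X n) [set A]%classic =
    mu (X n.+1) (restr_collection (leqnSn n) @^-1` [set A])%classic.
  by move=> A; exact: mu_restr.
have [c0 c1] := card_widen_imset (leqnSn n) (initial n r).
by rewrite sum_cap_ordS; congr (_ + _); apply: LambdaE;
  rewrite ?c0 ?c1 ?card_initial // leqW.
Qed.
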